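(* Let $G$ be a finite group, let $*$ be a nonidentical involutory antiautomorphism of $G$ with $gg^*\in Z(G)$ for every $g\in G$, and let $g_0\in Z(G)$ with $g_0^*=g_0$. Let $\beta\in\{xy,\,x^*y,\,yx,\,yx^*\}$, $\gamma\in\{xy,\,yx\}$ and $\delta\in\{g_0xy,\,g_0xy^*,\,g_0x^*y,\,g_0x^*y^*,\,g_0yx,\,g_0yx^*,\,g_0y^*x,\,g_0y^*x^*\}$. Then the loop $L=Q(G,*,g_0,\beta,\gamma,\delta)$ is left alternative if and only if at least one of the following holds: (a) $L$ is left Bol or an LC-loop; (b) $(\beta,\gamma,\delta)$ is among $(xy,xy,g_0x^*y)$, $(xy,yx,g_0yx^* )$, $(x^*y,xy,g_0x^*y)$, $(yx,xy,g_0x^*y)$, $(yx,yx,g_0yx^* )$, $(yx^*,xy,g_0x^*y)$, $(yx^*,yx,g_0yx^* )$; (c) $(xx)^*=xx$ for every $x\in G$ and $(\beta,\gamma,\delta)=(x^*y,xy,g_0xy)$.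
   Context: $Z(G)$ is the center of $G$. An involutory antiautomorphism $*$ of $G$ satisfies $(g^* )^*=g$ and $(gh)^*=h^*g^*$; nonidentical means $g^*\neq g$ for some $g\in G$. A word such as $yx^*$ or $g_0y^*x$ denotes the function $G\times G\to G$ sending $(x,y)$ to the value of the word. Words are regarded as functions: two words are identified when they define the same function on $G\times G$ (for instance $xy$ and $yx$ when $G$ is commutative), and equality of triples $(\beta,\gamma,\delta)$ means equality of the three functions. Let $Gu=\{gu : g\in G\}$ be a disjoint copy of $G$. The loop $Q(G,*,g_0,\beta,\gamma,\delta)$ is the set $G\cup Gu$ with the multiplication, for $x,y\in G$, $$x\circ y=xy,\quad x\circ yu=\beta(x,y)u,\quad xu\circ y=\gamma(x,y)u,\quad xu\circ yu=\delta(x,y).$$ It is a loop with neutral element $1\in G$. A loop is left alternative if it satisfies $x(xy)=(xx)y$, left Bol if it satisfies $x(y(xz))=(x(yx))z$, and an LC-loop if it satisfies $(xx)(yz)=(x(xy))z$. *)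

(* Defs.v *)
From mathcomp Require Import all_boot all_fingroup.

Set Implicit Arguments.
Unset Strict Implicit.
Unset Printing Implicit Defensive.

Local Open Scope group_scope.

Section LoopIdentities.

Variables (L : Type) (op : L -> L -> L).

Definition is_loop (e : L) : Prop :=
  [/\ left_id e op, right_id e op,
      forall a, bijective (op a) & forall a, bijective (op^~ a)].

Definition left_alternative : Prop :=
  forall x y, op x (op x y) = op (op x x) y.

Definition left_bol : Prop :=
  forall x y z, op x (op y (op x z)) = op (op x (op y x)) z.

Definition LC_identity : Prop :=
  forall x y z, op (op x x) (op y z) = op (op x (op x y)) z.

End LoopIdentities.

(* A word is the function it induces on pairs.  As [gT] is finite, equality of
   such finite functions is extensional and decidable. *)
Definition word (gT : finGroupType) (w : gT -> gT -> gT) :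
    {ffun gT * gT -> gT} :=
  [ffun p => w p.1 p.2].

(* In [gT + gT], [inl x] stands for [x] and [inr x] for [xu]. *)
Definition Qmul (gT : finGroupType) (beta gamma delta : {ffun gT * gT -> gT})
    (a b : gT + gT) : gT + gT :=
  match a, b with
  | inl x, inl y => inl (x * y)
  | inl x, inr y => inr (beta (x, y))
  | inr x, inl y => inr (gamma (x, y))
  | inr x, inr y => inl (delta (x, y))
  end.

Section Words.

Variables (gT : finGroupType) (star : gT -> gT) (g0 : gT).

Definition beta_words : seq {ffun gT * gT -> gT} :=
  [:: word (fun x y => x * y);
      word (fun x y => star x * y);
      word (fun x y => y * x);
      word (fun x y => y * star x)].

Definition gamma_words : seq {ffun gT * gT -> gT} :=
  [:: word (fun x y => x * y);
      word (fun x y => y * x)].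

Definition delta_words : seq {ffun gT * gT -> gT} :=
  [:: word (fun x y => g0 * x * y);
      word (fun x y => g0 * x * star y);
      word (fun x y => g0 * star x * y);
      word (fun x y => g0 * star x * star y);
      word (fun x y => g0 * y * x);
      word (fun x y => g0 * y * star x);
      word (fun x y => g0 * star y * x);
      word (fun x y => g0 * star y * star x)].

Lemma Qmul_is_loop (beta gamma delta : {ffun gT * gT -> gT}) :
  involutive star -> {morph star : g h / g * h >-> h * g} ->
  beta \in beta_words -> gamma \in gamma_words -> delta \in delta_words ->
  is_loop (Qmul beta gamma delta) (inl 1).
Proof.
move=> starK starM hb hc hd.
have star1 : star 1 = 1.
  by apply: (mulgI (star 1)); rewrite -starM !mulg1.
have starI := inv_inj starK.
have b1 y : beta (1, y) = y.
  by move: hb; rewrite !inE => /or4P[] /eqP ->;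
    rewrite ffunE /= ?star1 ?mul1g ?mulg1.
have c1 x : gamma (x, 1) = x.
  by move: hc; rewrite !inE => /orP[] /eqP ->; rewrite ffunE /= ?mul1g ?mulg1.
have bIr x : injective (fun y => beta (x, y)).
  by move: hb; rewrite !inE => /or4P[] /eqP -> y z; rewrite !ffunE /=;
    first [move/mulgI | move/mulIg].
have bIl y : injective (fun x => beta (x, y)).
  by move: hb; rewrite !inE => /or4P[] /eqP -> x z; rewrite !ffunE /=;
    first [move/mulgI | move/mulIg] => // /starI.
have cIr x : injective (fun y => gamma (x, y)).
  by move: hc; rewrite !inE => /orP[] /eqP -> y z; rewrite !ffunE /=;
    first [move/mulgI | move/mulIg].
have cIl y : injective (fun x => gamma (x, y)).
  by move: hc; rewrite !inE => /orP[] /eqP -> x z; rewrite !ffunE /=;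
    first [move/mulgI | move/mulIg].
have dIr x : injective (fun y => delta (x, y)).
  move: hd; rewrite !inE => /or4P[|||/or4P[|||/orP[]]] /eqP -> y z;
    rewrite !ffunE /= -?mulgA => /mulgI;
    by first [move/mulgI | move/mulIg] => // /starI.
have dIl y : injective (fun x => delta (x, y)).
  move: hd; rewrite !inE => /or4P[|||/or4P[|||/orP[]]] /eqP -> x z;
    rewrite !ffunE /= -?mulgA => /mulgI;
    by first [move/mulgI | move/mulIg] => // /starI.
split.
- by case=> y /=; rewrite ?mul1g ?b1.
- by case=> x /=; rewrite ?mulg1 ?c1.
- case=> x; apply: injF_bij; case=> y [] z //= [].
  + by move/mulgI ->.
  + by move/bIr ->.
  + by move/cIr ->.
  + by move/dIr ->.
- case=> y; apply: injF_bij; case=> x [] z //= [].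
  + by move/mulIg ->.
  + by move/cIl ->.
  + by move/bIl ->.
  + by move/dIl ->.
Qed.

End Words.

(* Main.v *)
Require Import Defs.
From mathcomp Require Import all_boot all_fingroup all_solvable.

Set Implicit Arguments.
Unset Strict Implicit.
Unset Printing Implicit Defensive.

Local Open Scope group_scope.

(* With [a = xu], left alternativity amounts to the two identities
     delta (x, gamma (x, y)) = delta (x, x) y,
     gamma (x, delta (x, y)) = beta (delta (x, x), y),
   the cases [a = x] being automatic.  Putting [x = 1] in the first one excludes
   every [delta] involving [y^*], and each remaining pair [(gamma, delta)] either
   satisfies it identically, or forces [G] to be commutative, or forces all
   squares to be central.  When [delta] is [g0 x y] or [g0 y x] and squares are
   central, [aa] is always an element [z] of [Z(G)] with [z (b c) = (z b) c], so
   left alternativity upgrades to the LC identity.  The words [x y], [x y],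
   [g0 x y] give an associative loop, and with [beta] replaced by [x^* y] the
   second identity says that squares are fixed by [*].  When [delta] involves [x^*],
   the centrality of [x x^*] makes the second identity hold for every [beta]. *)

Section LeftAlternative.

Variables (L : Type) (op : L -> L -> L) (e : L).

Lemma left_bol_alternative : left_id e op -> left_bol op -> left_alternative op.
Proof. by move=> op1l bol x y; have := bol x e y; rewrite !op1l. Qed.

Lemma LC_left_alternative :
  right_id e op -> LC_identity op -> left_alternative op.
Proof. by move=> op1r LC x y; have := LC x y e; rewrite !op1r. Qed.

Lemma left_alternative_LC :
    left_alternative op ->
    (forall x y z, op (op x x) (op y z) = op (op (op x x) y) z) ->
  LC_identity op.
Proof. by move=> alt nucl x y z; rewrite alt nucl. Qed.

End LeftAlternative.

Section QLoops.

Variables (gT : finGroupType) (star : gT -> gT) (g0 : gT).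
Hypotheses (starK : involutive star)
  (starM : forall g h : gT, star (g * h) = star h * star g)
  (star_nonid : exists g : gT, star g <> g)
  (star_central : forall g : gT, g * star g \in 'Z([set: gT]))
  (g0_central : g0 \in 'Z([set: gT]))
  (star_g0 : star g0 = g0).

Implicit Types (beta gamma delta : {ffun gT * gT -> gT}) (x y z : gT).

Lemma centerT_comm z : z \in 'Z([set: gT]) -> forall x, x * z = z * x.
Proof. by case/centerP=> _ zC x; rewrite (zC x) ?inE. Qed.

Let g0C := centerT_comm g0_central.
Let normC x := centerT_comm (star_central x).

Let star1 : star 1 = 1.
Proof. by apply: (mulgI (star 1)); rewrite -starM !mulg1. Qed.

Let star_norm x : star (x * star x) = x * star x.
Proof. by rewrite starM starK. Qed.

(** After left multiplication by [x], both sides are products of [x] with the central element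
    [x * star x]. *)
Let starx_x x : star x * x = x * star x.
Proof. by apply: (mulgI x); rewrite mulgA -normC. Qed.

Let starx_x_central x y : y * star x * x = x * star x * y.
Proof. by rewrite -mulgA starx_x normC. Qed.

Lemma Qmul_left_alternativeP beta gamma delta :
    beta \in beta_words star ->
  left_alternative (Qmul beta gamma delta) <->
    (forall x y, delta (x, gamma (x, y)) = delta (x, x) * y) /\
    (forall x y, gamma (x, delta (x, y)) = beta (delta (x, x), y)).
Proof.
move=> hb; split=> [alt | [altA altB]].
  split=> x y; first by have [] := alt (inr x) (inl y).
  by have [] := alt (inr x) (inr y).
case=> x [] y /=; rewrite ?altA ?altB // ?mulgA //; congr inr.
(* Each [beta] word multiplies [y] on a fixed side by [x] or [star x], so applying [beta (x, _)]
   twice is [beta (x * x, _)]. *)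
by move: hb; rewrite !inE => /or4P[] /eqP->; rewrite !ffunE /= ?starM !mulgA.
Qed.

Lemma beta_g0 beta x y :
  beta \in beta_words star -> beta (g0 * x, y) = g0 * beta (x, y).
Proof.
by rewrite !inE => /or4P[] /eqP->;
  rewrite !ffunE /= ?starM ?star_g0 -?g0C ?mulgA // !g0C ?mulgA.
Qed.

(** The last hypothesis says that [z] acts on the coset by plain multiplication. Neither [delta]
    word stars its first argument, so a central [z] comes out of it unchanged. *)
Lemma central_left_nuclear beta gamma delta z b c :
    beta \in beta_words star -> gamma \in gamma_words gT ->
    delta \in [:: word (fun x y => g0 * x * y); word (fun x y => g0 * y * x)] ->
    (forall y, y * z = z * y) -> (forall y, beta (z, y) = z * y) ->
  let op := Qmul beta gamma delta in
  op (inl z) (op b c) = op (op (inl z) b) c.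
Proof.
move=> hb hc hd zC hz; case: b c => [] y [] w //=; rewrite ?hz ?mulgA //.
(* At [y = 1], [hz] gives [star z = z] for the two words that star their first argument. *)
- have := hz 1; move: hb; rewrite !inE => /or4P[] /eqP->;
    rewrite !ffunE /= ?starM ?mul1g ?mulg1 => zE.
  + by rewrite mulgA.
  + by rewrite zE zC mulgA.
  + by rewrite -zC -mulgA zC.
  + by rewrite zE -zC mulgA.
- by move: hc; rewrite !inE => /orP[] /eqP->; rewrite !ffunE /= ?mulgA ?zC.
- move: hd; rewrite !inE => /orP[] /eqP->; rewrite !ffunE /=.
    by rewrite !mulgA zC.
  by rewrite -(zC y) -zC !mulgA.
Qed.

Lemma LC_of_central_squares beta gamma delta :
    beta \in beta_words star -> gamma \in gamma_words gT ->
    delta \in [:: word (fun x y => g0 * x * y); word (fun x y => g0 * y * x)] ->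
    (forall x y, y * (x * x) = x * x * y) ->
    (forall x y, beta (x * x, y) = x * x * y) ->
    left_alternative (Qmul beta gamma delta) ->
  LC_identity (Qmul beta gamma delta).
Proof.
move=> hb hc hd sqC hsq alt; apply: left_alternative_LC => // a b c.
case: a => x /=; first exact: central_left_nuclear.
have ->: delta (x, x) = g0 * (x * x).
  by move: hd; rewrite !inE => /orP[] /eqP->; rewrite ffunE mulgA.
(* The square of [xu] is [g0 * (x * x)], which is central too. *)
apply: central_left_nuclear => // y; first by rewrite mulgA g0C -!mulgA sqC -!mulgA.
by rewrite beta_g0 // hsq mulgA.
Qed.

(** This is the only [beta] missing from list (b) for this [(gamma, delta)]. The identity reduces to
    moving the central factors [g0] and [x * star x]. *)
Lemma left_bol_starxy_yx_yxstar :
  left_bol (Qmul (word (fun x y => star x * y)) (word (fun x y => y * x))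
                 (word (fun x y => g0 * y * star x))).
Proof.
move=> [] x [] y [] z /=; do 4!rewrite ?ffunE /=; rewrite ?starM ?starK ?star_g0.
all: rewrite !mulgA -?g0C //.
- by rewrite starx_x_central starx_x.
- rewrite starx_x_central (g0C z) (g0C x) -[g0 * x * star x]mulgA normC.
  by rewrite !mulgA.
- congr inl; rewrite -[LHS]mulgA normC -[star y * g0 * x * star x]mulgA.
  by rewrite normC !mulgA.
- by rewrite starx_x_central !mulgA.
- by congr inl; rewrite [RHS]g0C !mulgA -[g0 * z * g0]mulgA (g0C z) mulgA.
Qed.

(** All four words agree here because [x * star x] is central and fixed by [star]. *)
Lemma beta_g0_norm beta x y :
  beta \in beta_words star -> beta (g0 * (x * star x), y) = g0 * (x * star x * y).
Proof.
move=> hb; rewrite beta_g0 //; congr (g0 * _).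
by move: hb; rewrite !inE => /or4P[] /eqP->; rewrite ffunE /= ?star_norm ?normC.
Qed.

Lemma left_alternative_xy_xstary beta :
    beta \in beta_words star ->
  left_alternative (Qmul beta (word (fun x y => x * y))
                              (word (fun x y => g0 * star x * y))).
Proof.
move=> hb; apply/Qmul_left_alternativeP => //; split=> x y.
  by rewrite !ffunE /= !mulgA.
by rewrite !ffunE /= -[g0 * star x * x]mulgA starx_x beta_g0_norm // !mulgA g0C.
Qed.

Lemma left_alternative_yx_yxstar beta :
    beta \in beta_words star ->
  left_alternative (Qmul beta (word (fun x y => y * x))
                              (word (fun x y => g0 * y * star x))).
Proof.
move=> hb; apply/Qmul_left_alternativeP => //; split=> x y.
  by rewrite !ffunE /= -!mulgA normC -!mulgA.
rewrite !ffunE /= -[g0 * x * star x]mulgA beta_g0_norm //.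
by rewrite starx_x_central (mulgA g0) normC !mulgA.
Qed.

Lemma left_alternative_starxy_xy_xy :
    (forall x, star (x * x) = x * x) ->
  left_alternative (Qmul (word (fun x y => star x * y)) (word (fun x y => x * y))
                         (word (fun x y => g0 * x * y))).
Proof.
move=> starsq; apply/Qmul_left_alternativeP; first by rewrite !inE eqxx orbT.
split=> x y; rewrite !ffunE /= ?mulgA //.
by rewrite -[g0 * x * x]mulgA starM starsq star_g0 (g0C (x * x)) g0C !mulgA.
Qed.

(* When the word for [(gamma, delta)] forces [G] to be commutative, it agrees as
   a function with one of the four listed pairs. *)
Lemma left_alternative_gamma_delta beta gamma delta :
    beta \in beta_words star -> gamma \in gamma_words gT ->
    delta \in delta_words star g0 ->
    left_alternative (Qmul beta gamma delta) ->
  (gamma, delta) \in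
    [:: (word (fun x y => x * y), word (fun x y => g0 * x * y));
        (word (fun x y => x * y), word (fun x y => g0 * star x * y));
        (word (fun x y => y * x), word (fun x y => g0 * y * x));
        (word (fun x y => y * x), word (fun x y => g0 * y * star x))].
Proof.
move=> hb hc hd /(Qmul_left_alternativeP _ _ hb)[altA _].
have delta1 y : delta (1, y) = delta (1, 1) * y.
  rewrite -altA; congr (delta (1, _)); move: hc.
  by rewrite !inE => /orP[] /eqP->; rewrite ffunE /= ?mul1g ?mulg1.
have no_stary : ~ (forall y, delta (1, y) = g0 * star y).
  move=> E; case: star_nonid => y; apply; apply: (mulgI g0).
  by rewrite -E delta1 E star1 mulg1.
have words_comm : (forall x y : gT, x * y = y * x) ->
      [/\ word (fun x y => y * x) = word (fun x y => x * y :> gT),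
          word (fun x y => g0 * y * x) = word (fun x y => g0 * x * y)
        & word (fun x y => g0 * y * star x) = word (fun x y => g0 * star x * y)].
  by move=> mC; split; apply/ffunP=> -[x y]; rewrite !ffunE /= -?mulgA (mC y).
move: hd; rewrite !inE => /or4P[|||/or4P[|||/orP[]]] /eqP dE;
  try (by case: no_stary => y; rewrite dE ffunE /= ?star1 ?mulg1 ?mul1g);
  move: hc altA; rewrite dE !inE => /orP[] /eqP-> altA; rewrite ?eqxx ?orbT //;
  (* Four mismatched pairs remain; for each, cancellation in the first identity gives
     commutativity. *)
  suff /words_comm[E1 E2 E3] : (forall x y : gT, x * y = y * x) by
    rewrite ?E1 ?E2 ?E3 !eqxx ?orbT.
- move=> x y; have := altA x y.
  by rewrite !ffunE /= -[RHS]mulgA => /mulgI.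
- move=> x y; have := altA x y.
  by rewrite !ffunE /= -[RHS]mulgA => /mulgI.
- move=> x y; have := altA x y.
  by rewrite !ffunE /= -!mulgA => /mulgI/mulgI.
(* Cancellation only shows that [y] commutes with the star of the first argument, hence the instance
   at [star x]. *)
- move=> x y; have := altA (star x) y.
  by rewrite !ffunE /= starK -!mulgA => /mulgI/mulgI.
Qed.

Lemma left_alternative_xy_xy beta :
    beta \in beta_words star ->
    left_alternative (Qmul beta (word (fun x y => x * y))
                                (word (fun x y => g0 * x * y))) ->
  LC_identity (Qmul beta (word (fun x y => x * y))
                         (word (fun x y => g0 * x * y))) \/
  (forall x, star (x * x) = x * x) /\ beta = word (fun x y => star x * y).
Proof.
move=> hb alt; have [_ altB] := (Qmul_left_alternativeP _ _ hb).1 alt.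
have beta_sq x y : beta (x * x, y) = x * x * y.
  apply: (mulgI g0); rewrite -beta_g0 // mulgA.
  by have := altB x y; rewrite !ffunE /= => <-; rewrite !mulgA g0C.
have LC sqC := LC_of_central_squares hb _ _ sqC beta_sq alt.
(* For the successive words, [beta_sq] says: nothing; squares are fixed by [star]; squares are
   central; both of the latter. *)
move: (hb); rewrite !inE => /or4P[] /eqP bE.
- left=> -[] x [] y [] z; rewrite bE /=; do 4!rewrite ?ffunE /=;
    by rewrite !mulgA ?g0C ?mulgA.
- right; split=> // x.
  by have := beta_sq x 1; rewrite bE ffunE /= !mulg1.
- left; apply: LC; rewrite ?inE ?eqxx // => x y.
  by rewrite -beta_sq bE ffunE.
(* The instance at [y = 1] removes the star from the square; the general one then gives
   centrality. *)
- left; apply: LC; rewrite ?inE ?eqxx // => x y.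
  have := beta_sq x 1; have := beta_sq x y.
  by rewrite bE !ffunE /= mul1g mulg1 => <- ->.
Qed.

(** Here the first identity already makes squares central, whatever [beta] is, so no exceptional
    case arises. *)
Lemma left_alternative_yx_yx beta :
    beta \in beta_words star ->
    left_alternative (Qmul beta (word (fun x y => y * x))
                                (word (fun x y => g0 * y * x))) ->
  LC_identity (Qmul beta (word (fun x y => y * x))
                         (word (fun x y => g0 * y * x))).
Proof.
move=> hb alt; have [altA altB] := (Qmul_left_alternativeP _ _ hb).1 alt.
have sqC x y : y * (x * x) = x * x * y.
  by have := altA x y; rewrite !ffunE /= -!mulgA => /mulgI.
apply: (LC_of_central_squares hb); rewrite ?inE ?eqxx ?orbT // => x y.
apply: (mulgI g0); rewrite -beta_g0 // mulgA.
by have := altB x y; rewrite !ffunE /= => <-; rewrite -mulgA -mulgA sqC.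
Qed.

End QLoops.

Theorem theorem8p10 (gT : finGroupType) (star : gT -> gT) (g0 : gT)
  (beta gamma delta : {ffun gT * gT -> gT})
  (starK : involutive star)
  (starM : forall g h : gT, star (g * h) = star h * star g)
  (star_nonid : exists g : gT, star g <> g)
  (star_central : forall g : gT, g * star g \in 'Z([set: gT]))
  (g0_central : g0 \in 'Z([set: gT]))
  (star_g0 : star g0 = g0)
  (beta_word : beta \in beta_words star)
  (gamma_word : gamma \in gamma_words gT)
  (delta_word : delta \in delta_words star g0) :
  left_alternative (Qmul beta gamma delta) <->
  [\/ left_bol (Qmul beta gamma delta) \/ LC_identity (Qmul beta gamma delta),
      (beta, gamma, delta) \in
        [:: (word (fun x y => x * y), word (fun x y => x * y),
             word (fun x y => g0 * star x * y));
            (word (fun x y => x * y), word (fun x y => y * x),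
             word (fun x y => g0 * y * star x));
            (word (fun x y => star x * y), word (fun x y => x * y),
             word (fun x y => g0 * star x * y));
            (word (fun x y => y * x), word (fun x y => x * y),
             word (fun x y => g0 * star x * y));
            (word (fun x y => y * x), word (fun x y => y * x),
             word (fun x y => g0 * y * star x));
            (word (fun x y => y * star x), word (fun x y => x * y),
             word (fun x y => g0 * star x * y));
            (word (fun x y => y * star x), word (fun x y => y * x),
             word (fun x y => g0 * y * star x))]
    | (forall x : gT, star (x * x) = x * x) /\
      (beta, gamma, delta) =
        (word (fun x y => star x * y), word (fun x y => x * y),
         word (fun x y => g0 * x * y))].
Proof.
split=> [alt | ].
  have := left_alternative_gamma_delta starK starM star_nonid beta_word
    gamma_word delta_word alt.
  rewrite !inE => /or4P[] /eqP[cE dE]; rewrite {}cE {}dE in alt *.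
  - have [LC | [starsq ->]] := left_alternative_xy_xy starM g0_central star_g0
      beta_word alt.
      by constructor 1; right.
    by constructor 3.
  - constructor 2; move: beta_word.
    by rewrite !inE => /or4P[] /eqP->; rewrite eqxx ?orbT.
  - by constructor 1; right; apply: left_alternative_yx_yx alt.
  - move: beta_word; rewrite !inE => /or4P[] /eqP->.
    + by constructor 2; rewrite eqxx ?orbT.
    + by constructor 1; left; apply: left_bol_starxy_yx_yxstar.
    + by constructor 2; rewrite eqxx ?orbT.
    + by constructor 2; rewrite eqxx ?orbT.
have [op1l op1r _ _] := Qmul_is_loop starK starM beta_word gamma_word delta_word.
case=> [[bol | LC] | | [starsq [-> -> ->]]].
- exact: left_bol_alternative bol.
- exact: LC_left_alternative LC.
- rewrite !inE => /or4P[|||/or4P[]] /eqP[bE cE dE]; rewrite bE in beta_word;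
    rewrite {}bE {}cE {}dE;
    by [exact: left_alternative_xy_xstary | exact: left_alternative_yx_yxstar].
- exact: left_alternative_starxy_xy_xy.
Qed.
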